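(* Let $K,N,M\in\mathbb N$, let $(\mu^{(k)},\nu^{(k)})\in\Delta_N\times\Delta_M$, $k\in\{1,\dots,K\}$, be pairs of marginals, and let the corresponding total costs $\alpha^{(k)}\in\mathbb R$, optimal transport plans $\pi^{(k)}\in\Pi(\mu^{(k)},\nu^{(k)})$ and optimal potentials $(f^{(k)},g^{(k)})\in\mathbb R^N\times\mathbb R^M$, $k\in\{1,\dots,K\}$, be observed with respect to an underlying (consistent) cost matrix $c\in\mathbb R^{N\times M}$. Then $c$ is identifiable in $\mathbb R^{N\times M}$ if and only if for all $(i,j)\in\{1,\dots,N\}\times\{1,\dots,M\}$ there exists $k\in\{1,\dots,K\}$ such that $\pi^{(k)}_{i,j}>0$. In other words, $c$ is uniquely determined on $\bigcup_{k=1}^K\operatorname{supp}\pi^{(k)}$, i.e. all consistent cost matrices agree on the entries in this set.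
   Context: $\Delta_N=\{x\in\mathbb R^N: x_i\ge 0,\ \sum_i x_i=1\}$. For $\mu\in\Delta_N$, $\nu\in\Delta_M$, $\Pi(\mu,\nu)$ is the set of $N\times M$ matrices with nonnegative entries, row sums $\mu$ and column sums $\nu$. For $\pi\in\Pi(\mu,\nu)$, $\operatorname{supp}\pi=\{(i,j):\pi_{i,j}>0\}$. For $c\in\mathbb R^{N\times M}$, $\mathcal T_c(\mu,\nu)=\min_{\pi\in\Pi(\mu,\nu)}\langle c,\pi\rangle$ (Frobenius inner product) and $\Phi_c=\{(f,g)\in\mathbb R^N\times\mathbb R^M: f_i+g_j\le c_{i,j}\text{ for all }i,j\}$. A cost matrix $c$ is consistent with the observed information if for all $k$: $(f^{(k)},g^{(k)})\in\Phi_c$ and $\mathcal T_c(\mu^{(k)},\nu^{(k)})=\alpha^{(k)}=\langle c,\pi^{(k)}\rangle=\langle f^{(k)},\mu^{(k)}\rangle+\langle g^{(k)},\nu^{(k)}\rangle$. The cost matrix is identifiable in $\mathbb R^{N\times M}$ if there is exactly one consistent cost matrix (existence of at least one is assumed). *)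

(* Defs.v *)
From HB Require Import structures.
From mathcomp Require Import all_boot all_order all_algebra.
From mathcomp Require Import all_classical all_reals.
From mathcomp Require Import topology normedtype derive.

Set Implicit Arguments.
Unset Strict Implicit.
Unset Printing Implicit Defensive.
Import Order.TTheory GRing.Theory Num.Theory.
Import numFieldNormedType.Exports.
Local Open Scope classical_set_scope.
Local Open Scope ring_scope.

Definition simplex {R : realType} (n : nat) : set 'rV[R]_n :=
  [set x | (forall i, 0 <= x 0 i) /\ \sum_i x 0 i = 1].

Definition dot {R : realType} {n : nat} (x y : 'rV[R]_n) : R :=
  \sum_i x 0 i * y 0 i.

Definition frobenius {R : realType} {N M : nat} (c p : 'M[R]_(N, M)) : R :=
  \sum_i \sum_j c i j * p i j.

Definition couplings {R : realType} {N M : nat}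
    (mu : 'rV[R]_N) (nu : 'rV[R]_M) : set 'M[R]_(N, M) :=
  [set p | [/\ forall i j, 0 <= p i j,
               forall i, \sum_j p i j = mu 0 i
             & forall j, \sum_i p i j = nu 0 j]].

Definition supp {R : realType} {N M : nat} (p : 'M[R]_(N, M)) :
    set ('I_N * 'I_M) :=
  [set ij : 'I_N * 'I_M | 0 < p ij.1 ij.2].

(* For mu and nu in the simplices the infimum is attained, i.e. it is the
   minimum: see transport_cost_min. *)
Definition transport_cost {R : realType} {N M : nat} (c : 'M[R]_(N, M))
    (mu : 'rV[R]_N) (nu : 'rV[R]_M) : R :=
  inf [set frobenius c p | p in couplings mu nu].

Definition potentials {R : realType} {N M : nat} (c : 'M[R]_(N, M)) :
    set ('rV[R]_N * 'rV[R]_M) :=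
  [set fg : 'rV[R]_N * 'rV[R]_M | forall i j, fg.1 0 i + fg.2 0 j <= c i j].

Definition consistent {R : realType} {K N M : nat}
    (mu : 'I_K -> 'rV[R]_N) (nu : 'I_K -> 'rV[R]_M) (alpha : 'I_K -> R)
    (p : 'I_K -> 'M[R]_(N, M)) (f : 'I_K -> 'rV[R]_N) (g : 'I_K -> 'rV[R]_M)
    (c : 'M[R]_(N, M)) : Prop :=
  forall k,
    [/\ potentials c (f k, g k),
        transport_cost c (mu k) (nu k) = alpha k,
        alpha k = frobenius c (p k)
      & frobenius c (p k) = dot (f k) (mu k) + dot (g k) (nu k)].

Definition identifiable {R : realType} {K N M : nat}
    (mu : 'I_K -> 'rV[R]_N) (nu : 'I_K -> 'rV[R]_M) (alpha : 'I_K -> R)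
    (p : 'I_K -> 'M[R]_(N, M)) (f : 'I_K -> 'rV[R]_N) (g : 'I_K -> 'rV[R]_M) :
    Prop :=
  exists! c : 'M[R]_(N, M), consistent mu nu alpha p f g c.

Lemma couplings_nonempty {R : realType} {N M : nat}
    (mu : 'rV[R]_N) (nu : 'rV[R]_M) :
  simplex mu -> simplex nu -> couplings mu nu !=set0.
Proof.
move=> [mu0 mu1] [nu0 nu1]; exists (\matrix_(i, j) (mu 0 i * nu 0 j)).
split=> [i j|i|j].
- by rewrite mxE mulr_ge0.
- under eq_bigr do rewrite mxE.
  by rewrite -mulr_sumr nu1 mulr1.
- under eq_bigr do rewrite mxE.
  by rewrite -mulr_suml mu1 mul1r.
Qed.

Lemma continuous_lincomb {R : realType} {n : nat} (I : finType) (a : I -> R)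
    (h : I -> 'I_n) :
  continuous (fun v : 'rV[R]_n => \sum_i a i * v 0 (h i)).
Proof.
apply: (continuous_big (P := xpredT) (@add_continuous R)) => i _ v.
by apply: continuousM; [exact: cst_continuous|exact: coord_continuous].
Qed.

Lemma couplings_compact {R : realType} {N M : nat}
    (mu : 'rV[R]_N) (nu : 'rV[R]_M) :
  simplex nu -> compact [set v : 'rV[R]_(N * M) | couplings mu nu (vec_mx v)].
Proof.
move=> [nu0 nu1].
apply: (@subclosed_compact _ _
  [set v : 'rV[R]_(N * M) | forall k, `[0, 1]%classic (v 0 k)]).
- have -> : [set v : 'rV[R]_(N * M) | couplings mu nu (vec_mx v)] =
    (\bigcap_(ij in [set: 'I_N * 'I_M])
       [set v : 'rV[R]_(N * M) | 0 <= v 0 (mxvec_index ij.1 ij.2)]) `&`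
    ((\bigcap_(i in [set: 'I_N]) [set v : 'rV[R]_(N * M) |
        \sum_j 1 * v 0 (mxvec_index i j) = mu 0 i]) `&`
     (\bigcap_(j in [set: 'I_M]) [set v : 'rV[R]_(N * M) |
        \sum_i 1 * v 0 (mxvec_index i j) = nu 0 j])).
    have E (v : 'rV[R]_(N * M)) i j : vec_mx v i j = v 0 (mxvec_index i j).
      by rewrite mxE.
    apply/seteqP; split=> v /=.
      move=> [p0 pr pc]; split=> [[i j] _|]; first by have := p0 i j; rewrite E.
      split=> [i|j] _ /=; [rewrite -pr|rewrite -pc];
        by apply: eq_bigr => l _; rewrite E mul1r.
    move=> [p0 [pr pc]]; split=> [i j|i|j].
    + by rewrite E; exact: (p0 (i, j)).
    + by rewrite -(pr i)//; apply: eq_bigr => l _; rewrite E mul1r.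
    + by rewrite -(pc j)//; apply: eq_bigr => l _; rewrite E mul1r.
  apply: closedI; last apply: closedI; apply: closed_bigI => k _.
  + apply: (preimage_closed (f := fun v : 'rV[R]_(N * M) => v 0 _)
             (D := [set x : R | 0 <= x])) (@closed_ge _ _).
    by move=> v _; exact: coord_continuous.
  + apply: (preimage_closed (f := fun v : 'rV[R]_(N * M) => \sum_j 1 * v 0 _)
             (D := [set x : R | x = _])) (@closed_eq _ _).
    by move=> v _; exact:
      (@continuous_lincomb R _ _ (fun=> 1) (fun l => mxvec_index k l) v).
  + apply: (preimage_closed (f := fun v : 'rV[R]_(N * M) => \sum_j 1 * v 0 _)
             (D := [set x : R | x = _])) (@closed_eq _ _).
    by move=> v _; exact:
      (@continuous_lincomb R _ _ (fun=> 1) (fun l => mxvec_index l k) v).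
- apply: (@rV_compact R _ (fun=> `[0, 1]%classic)) => _.
  exact: segment_compact.
- move=> v [p0 _ pc] k /=; case/mxvec_indexP: k => i j.
  have := p0 i j; rewrite mxE => vij; rewrite in_itv/= vij/=.
  have le_nu : v 0 (mxvec_index i j) <= nu 0 j.
    rewrite -pc (bigD1 i)//= mxE lerDl; apply: sumr_ge0 => l _; exact: p0.
  apply: (le_trans le_nu); rewrite -nu1 (bigD1 j)//= lerDl.
  by apply: sumr_ge0.
Qed.

Lemma transport_cost_min {R : realType} {N M : nat} (c : 'M[R]_(N, M))
    (mu : 'rV[R]_N) (nu : 'rV[R]_M) :
  simplex mu -> simplex nu ->
  (exists2 p, couplings mu nu p & frobenius c p = transport_cost c mu nu) /\
  (forall p, couplings mu nu p -> transport_cost c mu nu <= frobenius c p).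
Proof.
move=> smu snu.
have [p0 Pp0] := couplings_nonempty smu snu.
pose F (v : 'rV[R]_(N * M)) := frobenius c (vec_mx v).
have contF : continuous F.
  have -> : F = fun v => \sum_(ij : 'I_N * 'I_M)
      c ij.1 ij.2 * v 0 (mxvec_index ij.1 ij.2).
    apply/funext => v; rewrite /F /frobenius pair_bigA/=.
    by apply: eq_bigr => ij _; rewrite mxE.
  exact: continuous_lincomb.
have [||v /set_mem Pv vmin] :=
    EVT_min_rV (f := F) _ (couplings_compact (mu := mu) snu) _.
- by exists (mxvec p0); rewrite /= mxvecK.
- exact: continuous_subspaceT.
have lbF : lbound [set frobenius c p | p in couplings mu nu] (F v).
  move=> _ [p Pp <-]; rewrite -[p]mxvecK; apply: vmin.
  by rewrite inE/= mxvecK.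
have TE : transport_cost c mu nu = F v.
  apply/eqP; rewrite eq_le; apply/andP; split.
    by apply: ge_inf; [exists (F v)|exists (vec_mx v)].
  by apply: lb_le_inf => //; exists (frobenius c p0), p0.
split; first by exists (vec_mx v).
by move=> p Pp; rewrite TE; apply: lbF; exists p.
Qed.

(* Main.v *)
Require Import Defs.
From HB Require Import structures.
From mathcomp Require Import all_boot all_order all_algebra.
From mathcomp Require Import all_classical all_reals.

(** For a coupling [q] of [mu] and [nu], the duality gap
    <c, q> - (<f, mu> + <g, nu>) is the sum over all (i, j) of
    (c i j - (f i + g j)) * q i j: expanding the marginals as row and column
    sums of [q] moves the potentials under the double sum ([duality_gapE]).
    When [(f, g)] is feasible for [c], every term is nonnegative, which has two
    consequences.

    - If the gap vanishes, so does every term, so that c i j = f i + g j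
      wherever [q] is positive ([complementary_slackness]).  The observed
      potentials do not depend on the cost, hence they determine each
      consistent cost on the union of the supports of the observed plans.
    - A feasible pair and a plan with zero gap are both optimal, so the transport
      cost is read off from them ([transport_cost_zero_gap]).  Hence consistency
      only constrains a cost through the inequalities f i + g j <= c i j and its
      values on the supports, and a cost can be raised freely at an entry that no
      observed plan charges ([consistent_raise]); this destroys uniqueness. *)

Local Open Scope classical_set_scope.
Local Open Scope ring_scope.
Import Order.TTheory GRing.Theory Num.Theory.

Lemma duality_gapE {R : realType} {N M : nat} (c q : 'M[R]_(N, M))
    (mu f : 'rV[R]_N) (nu g : 'rV[R]_M) :
  couplings mu nu q ->
  frobenius c q - (dot f mu + dot g nu) =
  \sum_i \sum_j (c i j - (f 0 i + g 0 j)) * q i j.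
Proof.
move=> [_ qmu qnu].
have -> : dot f mu = \sum_i \sum_j f 0 i * q i j.
  by apply: eq_bigr => i _; rewrite -qmu mulr_sumr.
have -> : dot g nu = \sum_i \sum_j g 0 j * q i j.
  rewrite exchange_big/=.
  by apply: eq_bigr => j _; rewrite -qnu mulr_sumr.
rewrite -big_split -sumrB/=; apply: eq_bigr => i _.
rewrite -big_split -sumrB/=; apply: eq_bigr => j _.
by rewrite mulrBl mulrDl.
Qed.

Lemma gap_term_ge0 {R : realType} {N M : nat} {c q : 'M[R]_(N, M)}
    {mu f : 'rV[R]_N} {nu g : 'rV[R]_M} :
  potentials c (f, g) -> couplings mu nu q ->
  forall i j, 0 <= (c i j - (f 0 i + g 0 j)) * q i j.
Proof. by move=> fg [q0 _ _] i j; rewrite mulr_ge0 ?subr_ge0//; exact: fg. Qed.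

Lemma weak_duality {R : realType} {N M : nat} (c q : 'M[R]_(N, M))
    (mu f : 'rV[R]_N) (nu g : 'rV[R]_M) :
  potentials c (f, g) -> couplings mu nu q ->
  dot f mu + dot g nu <= frobenius c q.
Proof.
move=> fg qc; rewrite -subr_ge0 (duality_gapE _ _ _ _ _ _ qc).
by do 2![apply: sumr_ge0 => ? _]; exact: (gap_term_ge0 fg qc).
Qed.

(** The gap is a sum of nonnegative terms, so it vanishes only termwise. *)
Lemma complementary_slackness {R : realType} {N M : nat} (c q : 'M[R]_(N, M))
    (mu f : 'rV[R]_N) (nu g : 'rV[R]_M) :
  potentials c (f, g) -> couplings mu nu q ->
  frobenius c q = dot f mu + dot g nu ->
  forall i j, 0 < q i j -> c i j = f 0 i + g 0 j.
Proof.
move=> fg qc /eqP; rewrite -subr_eq0 (duality_gapE _ _ _ _ _ _ qc) pair_bigA/=.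
rewrite psumr_eq0 => [/allP gap0 i j qij|ij _]; last exact: (gap_term_ge0 fg qc).
have /= := gap0 (i, j) (mem_index_enum _).
by rewrite mulf_eq0 (gt_eqF qij) orbF subr_eq0 => /eqP.
Qed.

(** Weak duality bounds every plan below by the dual value that [q] attains. *)
Lemma transport_cost_zero_gap {R : realType} {N M : nat} (c q : 'M[R]_(N, M))
    (mu f : 'rV[R]_N) (nu g : 'rV[R]_M) :
  potentials c (f, g) -> couplings mu nu q ->
  frobenius c q = dot f mu + dot g nu ->
  transport_cost c mu nu = frobenius c q.
Proof.
move=> fg qc gap0.
have lbq : lbound [set frobenius c r | r in couplings mu nu] (frobenius c q).
  by move=> _ [r rc <-]; rewrite gap0; exact: weak_duality.
apply/eqP; rewrite eq_le; apply/andP; split.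
  by apply: ge_inf; [exists (frobenius c q)|exists q].
by apply: lb_le_inf => //; exists (frobenius c q), q.
Qed.

(** At a charged entry a consistent cost equals the sum of the observed
    potentials, an expression in which the cost does not occur. *)
Lemma consistent_eq_on_supp {R : realType} {K N M : nat}
    (mu : 'I_K -> 'rV[R]_N) (nu : 'I_K -> 'rV[R]_M) (alpha : 'I_K -> R)
    (p : 'I_K -> 'M[R]_(N, M)) (f : 'I_K -> 'rV[R]_N) (g : 'I_K -> 'rV[R]_M)
    (hp : forall k, couplings (mu k) (nu k) (p k)) (c1 c2 : 'M[R]_(N, M)) :
  consistent mu nu alpha p f g c1 -> consistent mu nu alpha p f g c2 ->
  forall k i j, 0 < p k i j -> c1 i j = c2 i j.
Proof.
move=> h1 h2 k i j pij.
have [fg1 _ _ gap1] := h1 k; have [fg2 _ _ gap2] := h2 k.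
rewrite (complementary_slackness _ _ _ _ _ _ fg1 (hp k) gap1 _ _ pij).
by rewrite (complementary_slackness _ _ _ _ _ _ fg2 (hp k) gap2 _ _ pij).
Qed.

(** Raising a cost keeps the potentials feasible, and where no observed plan has
    mass it keeps the primal values; the gaps stay zero, so the observed plans
    and potentials remain optimal. *)
Lemma consistent_raise {R : realType} {K N M : nat}
    (mu : 'I_K -> 'rV[R]_N) (nu : 'I_K -> 'rV[R]_M) (alpha : 'I_K -> R)
    (p : 'I_K -> 'M[R]_(N, M)) (f : 'I_K -> 'rV[R]_N) (g : 'I_K -> 'rV[R]_M)
    (hp : forall k, couplings (mu k) (nu k) (p k)) (c d : 'M[R]_(N, M)) :
  consistent mu nu alpha p f g c ->
  (forall i j, 0 <= d i j) -> (forall k i j, d i j * p k i j = 0) ->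
  consistent mu nu alpha p f g (c + d).
Proof.
move=> hc d0 dp k; have [fg _ ac gap0] := hc k.
have fg' : potentials (c + d) (f k, g k).
  by move=> i j; rewrite mxE (le_trans (fg i j))// lerDl.
have cE : frobenius (c + d) (p k) = frobenius c (p k).
  apply: eq_bigr => i _; apply: eq_bigr => j _.
  by rewrite mxE mulrDl dp addr0.
have gap0' : frobenius (c + d) (p k) = dot (f k) (mu k) + dot (g k) (nu k).
  by rewrite cE.
split=> //; last by rewrite cE.
by rewrite (transport_cost_zero_gap _ _ _ _ _ _ fg' (hp k) gap0') cE.
Qed.

Theorem theorem2p36 (R : realType) (K N M : nat)
    (mu : 'I_K -> 'rV[R]_N) (nu : 'I_K -> 'rV[R]_M) (alpha : 'I_K -> R)
    (p : 'I_K -> 'M[R]_(N, M)) (f : 'I_K -> 'rV[R]_N) (g : 'I_K -> 'rV[R]_M)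
    (c : 'M[R]_(N, M))
    (hmu : forall k, simplex (mu k)) (hnu : forall k, simplex (nu k))
    (hp : forall k, couplings (mu k) (nu k) (p k))
    (hc : consistent mu nu alpha p f g c) :
  (identifiable mu nu alpha p f g <->
   forall (i : 'I_N) (j : 'I_M), exists k : 'I_K, 0 < p k i j) /\
  (forall c1 c2 : 'M[R]_(N, M),
     consistent mu nu alpha p f g c1 -> consistent mu nu alpha p f g c2 ->
     forall (i : 'I_N) (j : 'I_M),
       (\bigcup_(k in [set: 'I_K]) supp (p k)) (i, j) -> c1 i j = c2 i j).
Proof.
have eq_supp := consistent_eq_on_supp mu nu alpha p f g hp.
split; last first.
  by move=> c1 c2 h1 h2 i j [k _ pij]; exact: (eq_supp _ _ h1 h2 k).
split=> [[c' [_ uniq_c]] i j|cover]; last first.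
  exists c; split=> // c2 h2; apply/matrixP => i j.
  by have [k pij] := cover i j; exact: (eq_supp _ _ hc h2 k).
apply: contrapT => uncovered.
have p0 k : p k i j = 0.
  apply/eqP; rewrite eq_le; have [-> _ _] := hp k; rewrite andbT leNgt.
  by apply/negP => pij; apply: uncovered; exists k.
have hcd : consistent mu nu alpha p f g (c + delta_mx i j).
  apply: consistent_raise => // [i' j'|k i' j']; rewrite mxE ?ler0n//.
  by case: eqP => [->|_]; case: eqP => [->|_]; rewrite ?p0 ?mulr0 ?mul0r.
have := etrans (esym (uniq_c _ hc)) (uniq_c _ hcd).
move/matrixP/(_ i j)/eqP; rewrite !mxE !eqxx/=.
by rewrite addrC -subr_eq subrr eq_sym oner_eq0.
Qed.
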